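(* Let INSTANT be the online algorithm that, for every request $r$, at its arrival time $t(r)$ creates a service $(t(r),\{r\})$ serving only $r$. Then for every light stochastic instance $(T,\boldsymbol{\lambda})$, $$\limsup_{\tau\to\infty}\frac{\mathbb{E}[\mathrm{cost}(\mathrm{INSTANT}(\sigma),T)\mid \sigma\sim(T,\boldsymbol{\lambda})^\tau]}{\mathbb{E}[\mathrm{cost}(\mathrm{OPT}(\sigma),T)\mid \sigma\sim(T,\boldsymbol{\lambda})^\tau]}\le \frac{16}{3-3e^{-1}}\ (<8.44).$$
   Context: MLA with linear delays: $T$ is a finite tree with root $\gamma$ and positive edge weights; $d(u,v)$ denotes the total weight of the path between $u$ and $v$. A request $r=(t(r),\ell(r))$ has arrival time $t(r)$ and location $\ell(r)\in V(T)$. A schedule for a request sequence $\sigma$ is a set of services $s=(t(s),R(s))$ whose sets $R(s)$ partition $\sigma$ with $t(s)\ge t(r)$ for $r\in R(s)$. Weight of a service: total edge weight of the minimal subtree containing $\gamma$ and the locations of $R(s)$; delay: $\sum_{r\in R(s)}(t(s)-t(r))$; cost of a schedule: total weight plus total delay. $\mathrm{OPT}(\sigma)$ is a minimum-cost schedule. Stochastic instance $(T,\boldsymbol{\lambda})$: $\boldsymbol{\lambda}:V(T)\to\mathbb{R}_{\ge0}$, $\boldsymbol{\lambda}(\gamma)=0$; $\sigma\sim(T,\boldsymbol{\lambda})^\tau$ means requests arrive at each vertex $u$ according to independent Poisson processes of rate $\boldsymbol{\lambda}(u)$ over $[0,\tau]$. Heaviness: $\pi(T,\boldsymbol{\lambda})=\sum_{u\in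 V(T)}\boldsymbol{\lambda}(u)\,d(u,\gamma)$. The instance is light if $\pi(T,\boldsymbol{\lambda})\le 1$. *)

(* Defs.v *)
From HB Require Import structures.
From mathcomp Require Import all_boot all_order all_algebra.
From mathcomp Require Import all_classical all_reals all_analysis.

Set Implicit Arguments.
Unset Strict Implicit.
Unset Printing Implicit Defensive.

Import Order.TTheory GRing.Theory Num.Theory.

Local Open Scope ring_scope.

(* A finite rooted tree with positive edge weights: a connected acyclic simple
   graph, whose edges are two-element sets of vertices. [ucycle adj c] also
   holds of the degenerate closed walk [:: x; y] along a single edge, hence the
   bound 2 in [wtree_acyclic]. *)
Record wtree (R : realType) := WTree {
  vertex :> finType;
  root : vertex;
  edges : {set {set vertex}};
  edge_weight : {set vertex} -> R;
  adj := [rel x y : vertex | [set x; y]%SET \in edges];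
  wtree_edge2 : forall E, E \in edges -> #|E| = 2%N;
  wtree_connected : forall x y, connect adj x y;
  wtree_acyclic : forall c : seq vertex, ucycle adj c -> (size c <= 2)%N;
  wtree_weight_gt0 : forall E, E \in edges -> 0 < edge_weight E
}.

Section Tree.
Context {R : realType} {T : wtree R}.
Implicit Types (u v x y z : T) (p q : seq T) (S A : {set T}).

Definition simple_path u v : pred (seq T) :=
  fun p => [&& path (@adj _ T) u p, uniq (u :: p) & last u p == v].

Lemma simple_path_exists u v : exists p, simple_path u v p.
Proof.
have /connectP[p up ->] := wtree_connected u v.
case: (shortenP up) => q uq unq _.
by exists q; rewrite /simple_path uq unq eqxx.
Qed.

Lemma adj_sym : symmetric (@adj _ T).
Proof. by move=> x y; rewrite /= finset.setUC. Qed.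

Lemma simple_path_unique u v p q :
  simple_path u v p -> simple_path u v q -> p = q.
Proof.
elim: p u q => [|x p IHp] u q /and3P[up unp /eqP lp] /and3P[uq unq /eqP lq].
  case: q uq unq lq => // y q _; rewrite cons_uniq => /andP[nu _] lq.
  have eu : u = last y q by move: lq => /= ->.
  by rewrite eu mem_last in nu.
case: q uq unq lq => [_ _ /= lq|y q uq unq lq].
  have eu : u = last x p by rewrite lq -lp.
  by move: unp; rewrite cons_uniq eu mem_last.
have [exy|nxy] := eqVneq x y.
  subst y; congr (_ :: _).
  move: up unp uq unq lp lq => /= /andP[_ up] /andP[_ unp] /andP[_ uq]
    /andP[_ unq] lp lq.
  by apply: (IHp x); apply/and3P; split=> //; apply/eqP.
exfalso.
have hasq : has (mem (x :: p)) (y :: q).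
  apply/hasP; exists v; first by rewrite -lq -[last u _]/(last y q) mem_last.
  by rewrite -lp -[last u _]/(last x p); exact: mem_last.
have [z [q1 [q2 [eq pz nq1]]]] : exists z q1 q2,
    [/\ y :: q = rcons q1 z ++ q2, z \in x :: p & ~~ has (mem (x :: p)) q1].
  by case/split_find: hasq => z q1 q2 ? ?; exists z, q1, q2.
have [p1 [p2 ep]] : exists p1 p2, x :: p = rcons p1 z ++ p2.
  by case/splitPr: pz => p1 p2; exists p1, p2; rewrite cat_rcons.
have uc : ucycle (@adj _ T) (u :: rcons p1 z ++ rev q1).
  rewrite /ucycle; apply/andP; split.
    move: up uq; rewrite ep eq !cat_path => /andP[up _] /andP[uq _].
    rewrite /= rcons_cat cat_path up last_rcons /=.
    have := rev_path (@adj _ T) u (rcons q1 z).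
    rewrite last_rcons belast_rcons rev_cons => ->.
    by rewrite (eq_path (e' := @adj _ T)) // => a b; exact: adj_sym.
  move: unp unq nq1; rewrite ep eq 2!(cons_uniq u).
  move=> /andP[unp1 unp] /andP[unq1 unq] nq1.
  rewrite cons_uniq mem_cat mem_rev negb_or.
  move: unp unq unp1 unq1; rewrite !mem_cat !negb_or !cat_uniq.
  move=> /andP[unp _] /andP[unq _] /andP[-> _] /andP[].
  rewrite mem_rcons inE negb_or => /andP[_ ->] _ /=.
  rewrite unp rev_uniq /=; move: unq; rewrite rcons_uniq => /andP[_ ->].
  rewrite andbT; apply: contra nq1 => /hasP[a]; rewrite mem_rev => aq ap.
  by apply/hasP; exists a; rewrite //= mem_cat ap.
have := wtree_acyclic uc.
rewrite /= size_cat size_rcons size_rev addSn !ltnS leqn0 addn_eq0.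
case/andP=> /eqP/size0nil p10 /eqP/size0nil q10; move: nxy; move: ep eq; rewrite p10 q10 /=.
by case=> -> _ [-> _]; rewrite eqxx.
Qed.

Definition tree_path u v : seq T := xchoose (simple_path_exists u v).

Definition dist u v : R :=
  \sum_(E <- pairmap (fun x y => [set x; y]%SET) u (tree_path u v))
     edge_weight E.

(* A subtree is given by its vertex set: since T is acyclic, a subgraph that is
   a tree on S must contain all the edges of T between vertices of S. *)
Definition subtree S : bool :=
  [forall x in S, forall y in S, connect [rel a b in S | adj a b] x y].

Definition subtree_weight S : R :=
  \sum_(E in edges T | E \subset S) edge_weight E.

Lemma min_subtree_exists A :
  exists S, minset (fun S' => subtree S' && (A \subset S')) S.
Proof.
have [|S] := @minset_exists _ (fun S' => subtree S' && (A \subset S')) [set: T].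
  rewrite finset.subsetT andbT; apply/forall_inP => x _; apply/forall_inP => y _.
  rewrite (eq_connect (e' := @adj _ T)) ?wtree_connected // => a b.
  by rewrite /= !inE.
by move=> ? _; exists S.
Qed.

Definition min_subtree A : {set T} := xchoose (min_subtree_exists A).

End Tree.

Section MLA.
Context {R : realType} {T : wtree R}.

Definition request : Type := (R * T)%type.
Definition arrival_time (r : request) : R := r.1.
Definition location (r : request) : T := r.2.

Definition req (sigma : seq request) (i : 'I_(size sigma)) : request :=
  tnth (in_tuple sigma) i.

(* A service for sigma: its time, and the set of indices of the requests it
   serves (indices, so that requests with equal time and location are distinct
   elements of sigma). The order of sigma plays no role. *)
Definition service (sigma : seq request) : Type :=
  (R * {set 'I_(size sigma)})%type.

Section Schedules.
Variable sigma : seq request.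
Implicit Types (s : service sigma) (S : seq (service sigma)).

Definition is_schedule S : Prop :=
  [/\ uniq [seq s.2 | s <- S],
      finset.partition [set B in [seq s.2 | s <- S]]%SET [set: 'I_(size sigma)]
    & forall s, s \in S -> forall i, i \in s.2 -> arrival_time (req i) <= s.1].

Definition service_weight s : R :=
  subtree_weight (min_subtree (root T |: [set location (req i) | i in s.2])%SET).

Definition service_delay s : R :=
  \sum_(i in s.2) (s.1 - arrival_time (req i)).

Definition cost S : R :=
  \sum_(s <- S) service_weight s + \sum_(s <- S) service_delay s.

Definition optimal S : Prop :=
  is_schedule S /\ forall S', is_schedule S' -> cost S <= cost S'.

Definition INSTANT : seq (service sigma) :=
  [seq (arrival_time (req i), [set i]%SET) | i <- enum 'I_(size sigma)].

Lemma INSTANT_schedule : is_schedule INSTANT.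
Proof.
split.
- rewrite -map_comp map_inj_uniq ?enum_uniq // => i j /= eij.
  by apply/set1P; rewrite -eij set11.
- have memI (B : {set 'I_(size sigma)}) :
      B \in [set B in [seq s.2 | s <- INSTANT]]%SET -> exists i, B = [set i]%SET.
    by rewrite inE -map_comp => /mapP[i _ ->]; exists i.
  apply/and3P; split.
  + apply/eqP/setP => i; rewrite inE; apply/bigcupP.
    exists [set i]%SET; rewrite ?set11 // inE -map_comp.
    by apply/mapP; exists i; rewrite ?mem_enum.
  + apply/finset.trivIsetP => A B /memI[i ->] /memI[j ->] nij.
    by rewrite disjoints1 inE; apply: contra nij => /eqP ->.
  + by apply/negP => /memI[i] /setP/(_ i); rewrite !inE eqxx.
- by move=> _ /mapP[i _ ->] j /set1P ->.
Qed.

Lemma optimal_exists : exists S, optimal S.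
Proof.
pose a i := arrival_time (req (sigma := sigma) i).
have last_arrival (B : {set 'I_(size sigma)}) : exists m,
    (forall i, i \in B -> a i <= m) /\
    (forall m', B != finset.set0 -> (forall i, i \in B -> a i <= m') -> m <= m').
  have [->|[i0 i0B]] := set_0Vmem B.
    by exists 0; split=> [i|m']; rewrite ?inE ?eqxx.
  case: (@arg_maxP _ _ _ i0 (mem B) a i0B) => i iB imax.
  by exists (a i); split=> [|m' _]; [exact: imax|exact].
have [m mP] := choice last_arrival.
pose canon (Q : {set {set 'I_(size sigma)}}) : seq (service sigma) :=
  [seq (m B, B) | B <- enum Q].
have canon_sets Q : [seq s.2 | s <- canon Q] = enum Q.
  by rewrite -map_comp map_id.
have canonP Q : finset.partition Q [set: 'I_(size sigma)] -> is_schedule (canon Q).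
  move=> Qpart; split.
  - by rewrite canon_sets enum_uniq.
  - by rewrite canon_sets set_enum.
  - by move=> _ /mapP[B _ ->] i /= iB; apply: (mP B).1.
have [_ part0 _] := INSTANT_schedule.
case: (@arg_minP _ _ _ _ (fun Q => finset.partition Q [set: 'I_(size sigma)])
         (fun Q => cost (canon Q)) part0) => Q Qpart Qmin.
exists (canon Q); split; first exact: canonP.
move=> S [Suniq Spart Stime]; apply: (le_trans (Qmin _ Spart)).
rewrite /cost -!big_split /= big_map.
rewrite (perm_big [seq s.2 | s <- S]) /=; last first.
  by apply: uniq_perm => // [|B]; rewrite ?enum_uniq // mem_enum inE.
rewrite big_map big_seq [leRHS]big_seq; apply: ler_sum => s sS.
rewrite lerD2l; apply: ler_sum => i _; rewrite lerD2r; apply: (mP s.2).2.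
  case/and3P: Spart => _ _; apply: contra => /eqP <-.
  by rewrite inE map_f.
exact: Stime.
Qed.

Definition OPT : seq (service sigma) := sval (cid optimal_exists).

End Schedules.
End MLA.
Arguments request {R} T.

Section Stochastic.
Context {R : realType}.

Definition stochastic_instance (T : wtree R) (lambda : T -> R) : Prop :=
  (forall u, 0 <= lambda u) /\ lambda (root T) = 0.

Definition heaviness (T : wtree R) (lambda : T -> R) : R :=
  \sum_(u : T) lambda u * dist u (root T).

Definition light (T : wtree R) (lambda : T -> R) : Prop :=
  heaviness lambda <= 1.

Local Open Scope classical_set_scope.

(* Mutual independence of a finite family of nat-valued random variables; the
   subfamilies are covered by taking A i to be everything. *)
Definition mutually_independent d (Omega : measurableType d)
    (P : probability Omega R) (I : finType) (X : I -> Omega -> nat) : Prop :=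
  forall A : I -> set nat,
    P [set w | forall i, A i (X i w)] = (\prod_(i : I) P (X i @^-1` A i))%E.

Definition arrivals (T : wtree R) (u : T) (s t : R) (sigma : seq (request T))
    : nat :=
  count (fun r => (location r == u) && (s < arrival_time r <= t)) sigma.

(* sigma ~ (T, lambda)^tau: the requests at each vertex u form a Poisson process
   of rate lambda u over [0, tau] (no arrival at time 0, independent increments,
   the number of arrivals in ]s, t] being Poisson of parameter
   lambda u * (t - s)), and the processes of the different vertices are
   independent. The last clause states both independences: for times
   0 <= t 0 <= ... <= t n <= tau, the numbers of arrivals at u in ]t j, t j.+1]
   are independent jointly over all u and j < n. The Poisson mass function is
   written out because [poisson_pmf] is identically 1 at parameter 0, where the
   distribution should be the Dirac mass at 0 (0 ^+ 0 = 1). *)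
Definition poisson_requests (T : wtree R) (lambda : T -> R) (tau : R)
    d (Omega : measurableType d) (P : probability Omega R)
    (sigma : Omega -> seq (request T)) : Prop :=
  [/\ forall w (r : request T), r \in sigma w -> 0 <= arrival_time r <= tau,
      {ae P, forall w, forall r : request T, r \in sigma w ->
        arrival_time r != 0},
      forall (u : T) (s t : R), 0 <= s -> s <= t -> t <= tau ->
        measurable_fun setT (fun w => arrivals u s t (sigma w)),
      forall (u : T) (s t : R), 0 <= s -> s <= t -> t <= tau -> forall k : nat,
        let a := lambda u * (t - s) in
        P [set w | arrivals u s t (sigma w) = k]
          = (a ^+ k / k`!%:R * expR (- a))%:E
    & forall (n : nat) (t : nat -> R), 0 <= t 0%N -> t n <= tau ->
        (forall j, (j < n)%N -> t j <= t j.+1) ->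
        mutually_independent P (fun (uj : T * 'I_n) w =>
          arrivals uj.1 (t uj.2) (t uj.2.+1) (sigma w)) ].

End Stochastic.

(* Main.v *)
(* A service of INSTANT costs the depth of its request, so the expected cost of
   INSTANT is tau times the heaviness pi. To bound OPT from below, put in class j
   the vertices whose depth lies in [L_j, 2 L_j), where L_j = m 2^j, and consider
   the windows of length L_j starting at the multiples of L_j / 4. In a light
   instance the rate Lambda_j of class j satisfies Lambda_j L_j <= 1, so such a
   window is hit by a request of class j with probability
   1 - exp(- Lambda_j L_j) >= (1 - 1/e) Lambda_j L_j. In any schedule, the windows
   hit by the class-j requests of one service number at most
   5 + 4 delay_j / L_j, and the L_j of the classes met by the service sum up to at
   most twice its weight; hence the sum over all hit windows of L_j / 4 is at most
   5/2 of the cost. Taking expectations, and losing a factor 15/16 to the windows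
   that do not fit in [0, tau] and a factor 2 to the rounding of depths,
   E[OPT] >= 2/5 * 15/16 * (1 - 1/e) * tau * pi / 2 = 3/16 * (1 - 1/e) * tau * pi. *)
Require Import Defs.
From mathcomp Require Import all_boot all_order all_algebra.
From mathcomp Require Import all_classical all_reals all_analysis.
From mathcomp Require Import measurable_realfun zify ring lra.
Import numFieldNormedType.Exports.
Import Order.TTheory GRing.Theory Num.Theory.

Set Implicit Arguments.
Unset Strict Implicit.
Unset Printing Implicit Defensive.

(** * Simple paths and minimal subtrees *)

Section TreeFacts.
Local Open Scope ring_scope.
Context {R : realType} {T : wtree R}.
Implicit Types (u v x y : T) (p : seq T) (S A : {set T}).

Let edge x y : {set T} := [set x; y]%SET.

Lemma tree_pathP u v : simple_path u v (tree_path u v).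
Proof. exact: (xchooseP (simple_path_exists u v)). Qed.

Lemma path_edges_vertices u p E x :
  E \in pairmap edge u p -> x \in E -> x \in u :: p.
Proof.
elim: p u => // y p IHp u /=; rewrite inE => /orP[/eqP ->|/IHp h /h xp].
  by rewrite !inE => /orP[->|/eqP ->] //; rewrite eqxx orbT.
by rewrite inE xp orbT.
Qed.

Lemma path_edges_uniq u p : uniq (u :: p) -> uniq (pairmap edge u p).
Proof.
elim: p u => // y p IHp u /[!cons_uniq] /andP[nu unp].
rewrite /= IHp // andbT; apply: contra nu => /path_edges_vertices; apply.
by rewrite !inE eqxx.
Qed.

Lemma path_edges_sub u p E :
  path (@adj _ T) u p -> E \in pairmap edge u p -> E \in edges T.
Proof.
elim: p u => // y p IHp u /= /andP[uy yp]; rewrite inE => /orP[/eqP ->|] //.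
exact: IHp.
Qed.

(* An edge joining the start of a simple path to one of its vertices is itself a
   simple path, hence is the first edge by uniqueness of simple paths. *)
Lemma simple_path_chord u v p y :
  simple_path u v p -> y \in p -> adj u y -> edge u y \in pairmap edge u p.
Proof.
move=> /and3P[up unp _] yp uy.
case/splitPr: yp up unp => p1 p2; rewrite -cat_rcons cat_path => /andP[up1 _].
rewrite -cat_cons cat_uniq => /andP[unp1 _].
have s1 : simple_path u y (rcons p1 y).
  by apply/and3P; split; rewrite ?last_rcons.
have s2 : simple_path u y [:: y].
  have nuy : u != y.
    by apply: contraTneq unp1 => ->; rewrite /= mem_rcons mem_head.
  by apply/and3P; split; rewrite /= ?inE ?andbT.
by rewrite (simple_path_unique s1 s2) /= mem_head.
Qed.

Lemma simple_path_behead u v x p :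
  simple_path u v (x :: p) -> simple_path x v p.
Proof.
by case/and3P => /= /andP[_ xp] /andP[_ unp] lp; apply/and3P; split.
Qed.

(** By induction along the path: an edge avoiding [u] lies within the remaining vertices, and an
    edge from [u] ends further along the path, so it is a chord at [u]. *)
Lemma edge_in_path u v p E :
  simple_path u v p -> E \in edges T -> E \subset [set x in u :: p]%SET ->
  E \in pairmap edge u p.
Proof.
elim: p u => [|y p IHp] u up ET sE.
  have := subset_leq_card sE; rewrite (wtree_edge2 ET).
  by rewrite set_seq1 cards1.
have [uE|uE] := boolP (u \in E); last first.
  rewrite /= inE (IHp y (simple_path_behead up) ET) ?orbT //.
  apply/fintype.subsetP => x xE; have /= := fintype.subsetP sE x xE; rewrite !inE.
  by case/orP => // /eqP xu; rewrite -xu xE in uE.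
have [a [b [nab eE]]] : exists a b, a != b /\ E = [set a; b]%SET.
  have /cards2P[a [b [? ?]]] : #|E| == 2%N by rewrite (wtree_edge2 ET).
  by exists a, b.
have [c [nc eE']] : exists c, u != c /\ E = [set u; c]%SET.
  move: uE; rewrite eE !inE => /orP[/eqP ->|/eqP ->]; first by exists b.
  by exists a; rewrite eq_sym nab finset.setUC.
rewrite eE'; apply: (simple_path_chord up); last by rewrite /= -eE'.
have : c \in u :: y :: p.
  have := fintype.subsetP sE c; rewrite eE' !inE eqxx orbT; exact.
by rewrite inE eq_sym (negPf nc).
Qed.

(** The edges of [T] inside the vertex set of a simple path are exactly the edges of the path, each
    occurring once. *)
Lemma subtree_weight_path u v :
  subtree_weight [set x in u :: tree_path u v]%SET = dist u v.
Proof.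
have up := tree_pathP u v; have /and3P[upp unp _] := up.
rewrite /subtree_weight /dist -/edge [RHS]big_uniq; last exact: path_edges_uniq.
rewrite [LHS]big_mkcond [RHS]big_mkcond /=; apply: eq_bigr => E _.
have [Ep|Ep] := boolP (E \in pairmap edge u _).
  rewrite (path_edges_sub upp Ep) /=.
  case: ifP => // /negP[]; apply/fintype.subsetP => x xE.
  by rewrite inE; exact: path_edges_vertices Ep xE.
by case: ifP => // /andP[ET sE]; rewrite (edge_in_path up) in Ep.
Qed.

(** A walk inside [S] shortens to a simple path inside [S], and simple paths are unique. *)
Lemma path_subset_subtree S u v :
  subtree S -> u \in S -> v \in S -> [set x in u :: tree_path u v]%SET \subset S.
Proof.
move=> /forall_inP/(_ u) + uS vS => /(_ uS)/forall_inP/(_ v vS).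
case/connectP => p; case/shortenP => q uq unq _ lq.
have qS : {subset u :: q <= S}.
  move=> x; rewrite inE => /orP[/eqP -> //|].
  move: (u) uq; elim: q {unq lq} => // y q IHq z.
  move=> /= /andP[/andP[/andP[_ yS] _] yq]; rewrite inE => /orP[/eqP -> //|].
  exact: IHq yq.
have sq : simple_path u v q.
  apply/and3P; split => //; last by rewrite lq.
  by apply: sub_path uq => a b /andP[].
rewrite (simple_path_unique (tree_pathP u v) sq).
by apply/fintype.subsetP => x; rewrite inE; exact: qS.
Qed.

Lemma path_subtree u v : subtree [set x in u :: tree_path u v]%SET.
Proof.
set S := [set x in _]%SET.
have /and3P[up unp _] := tree_pathP u v.
have cS x : x \in S -> connect [rel a b in S | adj a b] u x.
  rewrite inE => xp; have {}up : path [rel a b in S | adj a b] u (tree_path u v).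
    have pathS w q : path (@adj _ T) w q -> {subset w :: q <= S} ->
        path [rel a b in S | adj a b] w q.
      elim: q w => // b q IHq w /= /andP[-> bq] sS.
      rewrite !sS ?inE ?eqxx ?orbT //=; apply: IHq => // a aq; apply: sS.
      by rewrite inE aq orbT.
    by apply: pathS => // a ap; rewrite finset.inE.
  move: up.
  case/splitPl: xp => p1 p2 lp; rewrite cat_path => /andP[up1 _].
  by apply/connectP; exists p1.
have sS : symmetric [rel a b in S | adj a b].
  by move=> a b; rewrite /= (andbC (a \in S)) finset.setUC.
apply/forall_inP => x xS; apply/forall_inP => y yS.
by apply: connect_trans (cS y yS); rewrite (sym_connect_sym sS) cS.
Qed.

Lemma min_subtreeP A :
  subtree (min_subtree A) /\ A \subset min_subtree A.
Proof.
by have /minsetP[/andP[? ?] _] := xchooseP (min_subtree_exists A).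
Qed.

Lemma le_subtree_weight S S' :
  S \subset S' -> subtree_weight S <= subtree_weight S' :> R.
Proof.
move=> sS; rewrite /subtree_weight [leLHS]big_mkcondr [leRHS]big_mkcondr.
apply: ler_sum => E ET; case: ifP => [ES|_]; last first.
  by case: ifP => // _; exact/ltW/wtree_weight_gt0.
by rewrite (fintype.subset_trans ES sS).
Qed.

Lemma dist_le_min_subtree A u v :
  u \in A -> v \in A -> dist u v <= subtree_weight (min_subtree A) :> R.
Proof.
move=> uA vA; have [sA AA] := min_subtreeP A.
rewrite -subtree_weight_path; apply: le_subtree_weight.
by apply: path_subset_subtree; rewrite // (fintype.subsetP AA).
Qed.

(** The vertices of the path form a subtree containing both ends and lying inside the minimal one,
    hence equal to it. *)
Lemma min_subtree2_weight u v :
  subtree_weight (min_subtree [set v; u]%SET) = dist u v.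
Proof.
apply/le_anti; rewrite dist_le_min_subtree ?inE ?eqxx ?orbT // andbT.
rewrite -subtree_weight_path; apply: le_subtree_weight.
set S := [set x in _]%SET; set A := [set v; u]%SET.
have [sA AA] := min_subtreeP A.
have /minsetP[_ minA] := xchooseP (min_subtree_exists A).
rewrite -/(min_subtree A) in minA; rewrite -(minA S) //.
  rewrite path_subtree; apply/fintype.subsetP => x; rewrite finset.in_set2 finset.in_set.
  have /and3P[_ _ /eqP lp] := tree_pathP u v.
  by case/orP => /eqP ->; rewrite ?mem_head // -{1}lp mem_last.
by apply: path_subset_subtree => //; apply: (fintype.subsetP AA);
  rewrite !inE eqxx ?orbT.
Qed.

Lemma dist_ge0 u v : 0 <= dist u v :> R.
Proof.
rewrite -subtree_weight_path; apply: sumr_ge0 => E /andP[ET _].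
exact/ltW/wtree_weight_gt0.
Qed.

End TreeFacts.

(** * Cost of [INSTANT] and of general services *)

Section Costs.
Local Open Scope ring_scope.
Context {R : realType} {T : wtree R}.
Implicit Types (u : T) (sigma : seq (request T)).

Lemma cost_INSTANT sigma :
  cost (INSTANT sigma) = \sum_(r <- sigma) dist (location r) (Defs.root T).
Proof.
have sumE (F : service sigma -> R) : \sum_(s <- INSTANT sigma) F s =
    \sum_(i < size sigma) F (arrival_time (req i), [set i]%SET).
  by rewrite big_map big_enum.
rewrite /cost !sumE [X in _ + X]big1 ?addr0 => [|i _]; last first.
  by apply: big1 => j /set1P ->; rewrite subrr.
rewrite -[in RHS](in_tupleE sigma) big_tuple; apply: eq_bigr => i _.
by rewrite /service_weight /= imset_set1 min_subtree2_weight.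
Qed.

Lemma dist_le_service_weight sigma (s : service sigma) i :
  i \in s.2 -> dist (location (req i)) (Defs.root T) <= service_weight s.
Proof.
move=> si; apply: dist_le_min_subtree; rewrite !inE ?eqxx //.
by apply/orP; right; apply/imsetP; exists i.
Qed.

Lemma service_weight_ge0 sigma (s : service sigma) : 0 <= service_weight s.
Proof. by apply: sumr_ge0 => E /andP[ET _]; exact/ltW/wtree_weight_gt0. Qed.

Lemma service_delay_ge0 sigma (s : service sigma) :
  (forall i, i \in s.2 -> arrival_time (req i) <= s.1) -> 0 <= service_delay s.
Proof. by move=> st; apply: sumr_ge0 => i si; rewrite subr_ge0 st. Qed.

Lemma cost_ge0 sigma (S : seq (service sigma)) : is_schedule S -> 0 <= cost S.
Proof.
case=> _ _ St; rewrite /cost addr_ge0 // big_seq sumr_ge0 // => s sS.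
  exact: service_weight_ge0.
exact/service_delay_ge0/St.
Qed.

Lemma OPT_schedule sigma : is_schedule (OPT sigma).
Proof. by have [] := svalP (cid (optimal_exists sigma)). Qed.

End Costs.

(** * Counting windows and summing dyadic scales *)

Section Windows.
Local Open Scope ring_scope.
Context {R : realType}.

(** Half-open on the left, like the intervals of [arrivals], so that hitting a window is the
    complement of a void event. *)
Definition window (h : R) (k : nat) (a : R) : bool :=
  k%:R * h < a <= (k + 4)%:R * h.

(** Subtracting the least element embeds [A] into the numbers from [0] to [b]. Truncated subtraction
    makes the hypothesis bite only when [i < j]. *)
Lemma card_ord_diam n (A : {set 'I_n}) (b : nat) :
  (forall i j, i \in A -> j \in A -> (j - i <= b)%N) -> (#|A| <= b.+1)%N.
Proof.
have [->|[i0 i0A]] := set_0Vmem A; first by rewrite cards0.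
move=> Ab; case: (@arg_minnP _ i0 (mem A) (fun i => nat_of_ord i) i0A) => i iA imin.
rewrite cardE -(size_map (fun j : 'I_n => (j - i)%N)) -(size_iota 0 b.+1).
apply: uniq_leq_size => [|_ /mapP[j + ->]]; last first.
  by rewrite mem_enum mem_iota /= add0n ltnS => jA; exact: Ab.
rewrite map_inj_in_uniq ?enum_uniq // => j k; rewrite !mem_enum => jA kA jk.
by apply: val_inj => /=; rewrite -(subnK (imin j jA)) jk subnK // imin.
Qed.

(* The windows hit by the requests of [B] span at most [t - min a + 4 h], hence
   the extra [5 * h], which is only paid once. *)
Lemma window_count (I : finType) (B : {set I}) (a : I -> R) (t h : R) n :
  0 < h -> (forall i, i \in B -> a i <= t) ->
  \sum_(k < n) h * [exists i in B, window h k (a i)]%:R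
    <= (B != finset.set0)%:R * (5 * h) + \sum_(i in B) (t - a i).
Proof.
move=> h0 at_.
have d0 i : i \in B -> 0 <= t - a i by move=> iB; rewrite subr_ge0 at_.
have [B0|[b0 b0B]] := set_0Vmem B.
  rewrite B0 eqxx mul0r add0r big_set0 big1 // => k _.
  case: existsP => [[i]|]; last by rewrite mulr0.
  by rewrite inE.
have -> : B != finset.set0 by apply/set0Pn; exists b0.
rewrite mul1r -mulr_sumr -natr_sum.
set D := \sum_(i in B) _.
pose A := [set k : 'I_n | [exists i in B, window h k (a i)]]%SET.
have -> : (\sum_(k < n) [exists i in B, window h k (a i)] = #|A|)%N.
  rewrite -sum1_card [RHS]big_mkcond /=; apply: eq_bigr => k _.
  by rewrite inE; case: existsP.
have D0 : 0 <= D by apply: sumr_ge0.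
have dD i : i \in B -> t - a i <= D.
  move=> iB; rewrite /D (bigD1 i) //= lerDl; apply: sumr_ge0 => j /andP[jB _].
  exact: d0.
(* A request in window [j] arrives after [j * h] and by [t]; one in window [i] arrives by
   [(i + 4) * h]. *)
have key i j : i \in A -> j \in A -> (j%:R - i%:R) * h < 4 * h + D.
  rewrite !inE => /exists_inP[b bB /andP[_ b2]] /exists_inP[c cB /andP[c1 _]].
  have := dD b bB; have := at_ c cB; rewrite natrD in b2.
  rewrite mulrBl; move: b2 c1; rewrite mulrDl; lra.
have q0 : 0 <= 4 + D / h by rewrite addr_ge0 // divr_ge0 // ltW.
have : (#|A| <= (Num.truncn (4 + D / h)).+1)%N.
  apply: card_ord_diam => i j iA jA.
  rewrite truncn_ge_nat //; have [ij|ji] := leqP i j; last first.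
    by rewrite (eqP (ltnW ji)).
  rewrite natrB // -(ler_pM2r h0) [leRHS]mulrDl divfK ?gt_eqF //; exact/ltW/key.
rewrite -(ler_nat R) -(ler_pM2l h0) => /le_trans; apply.
rewrite -natr1 mulrDr mulr1.
have /andP[+ _] := truncn_itv q0.
move=> /(ler_wpM2l (ltW h0)).
rewrite [leRHS]mulrDr [h * (D / h)]mulrC divfK ?gt_eqF //.
by lra.
Qed.

(** The last term with [Q] is at most [D], and all earlier terms together do not exceed it. *)
Lemma geometric_sum_le (m D : R) (Q : pred nat) K :
  0 <= m -> 0 <= D -> (forall j, Q j -> m * 2 ^+ j <= D) ->
  \sum_(j < K | Q j) m * 2 ^+ j <= 2 * D.
Proof.
move=> m0 D0 QD; elim: K => [|K IHK]; first by rewrite big_ord0 mulr_ge0.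
rewrite big_mkcond big_ord_recr /= -big_mkcond /=.
case: ifPn => [QK|_]; last by rewrite addr0.
have le j : \sum_(i < j | Q i) m * 2 ^+ i <= m * (2 ^+ j - 1).
  elim: j => [|j IHj]; first by rewrite big_ord0 expr0 subrr mulr0.
  rewrite big_mkcond big_ord_recr /= -big_mkcond /= exprS.
  have : 0 <= m * 2 ^+ j by rewrite mulr_ge0 // exprn_ge0.
  by case: ifP => _; move: IHj; lra.
by have := le K; have := QD K QK; move: m0; lra.
Qed.

End Windows.

(** * Deterministic lower bound on the cost of a schedule *)

Section LowerBound.
Local Open Scope ring_scope.
Context {R : realType} {T : wtree R}.
Variable m : R.
Hypothesis m_gt0 : 0 < m.
Implicit Types (u : T) (j k : nat) (sigma : seq (request T)).

Definition scale j : R := m * 2 ^+ j.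

Definition depth_class j u : bool := scale j <= dist u (Defs.root T) < scale j.+1.

(* Makes [window (step j) k] an interval of length [scale j]. *)
Definition step j : R := scale j / 4.

Definition class_hit sigma j k : bool :=
  has (fun r => depth_class j (location r) && window (step j) k (arrival_time r))
    sigma.

Lemma scale_gt0 j : 0 < scale j.
Proof. by rewrite mulr_gt0 // exprn_gt0. Qed.

Lemma step_gt0 j : 0 < step j.
Proof. by rewrite divr_gt0 // scale_gt0. Qed.

Lemma le_scale i j : (i <= j)%N -> scale i <= scale j.
Proof. by move=> ij; rewrite ler_pM2l // ler_eXn2l // ltr1n. Qed.

Lemma depth_class_inj u i j : depth_class i u -> depth_class j u -> i = j.
Proof.
move=> /andP[i1 i2] /andP[j1 j2]; apply/eqP; rewrite eqn_leq.
have le a b : scale a <= dist u (Defs.root T) ->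
    dist u (Defs.root T) < scale b.+1 -> (a <= b)%N.
  move=> au ub; rewrite leqNgt; apply/negP => /le_scale ba.
  by have := lt_le_trans (le_lt_trans au ub) ba; rewrite ltxx.
by rewrite !le.
Qed.

(** Each class met by the service contributes at most [5 * step j], that is [5 / 4 * scale j], plus
    its own delay. The scales of the classes met are dyadic and bounded by the weight, so they sum
    to at most twice the weight. *)
Lemma service_lower_bound sigma (s : service sigma) K (n : nat -> nat) :
  (forall i, i \in s.2 -> arrival_time (req i) <= s.1) ->
  \sum_(j < K) \sum_(k < n j) step j *
     [exists i in s.2, depth_class j (location (req i)) &&
                       window (step j) k (arrival_time (req i))]%:R
  <= 5 / 2 * service_weight s + service_delay s.
Proof.
move=> st.
pose B j := [set i in s.2 | depth_class j (location (req i))]%SET.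
have BE j k : [exists i in s.2, depth_class j (location (req i)) &&
      window (step j) k (arrival_time (req i))] =
    [exists i in B j, window (step j) k (arrival_time (req i))].
  by apply: eq_existsb => i; rewrite inE andbA.
under eq_bigr => j _ do under eq_bigr => k _ do rewrite BE.
apply: (@le_trans _ _ (\sum_(j < K) ((B j != finset.set0)%:R * (5 * step j) +
    \sum_(i in B j) (s.1 - arrival_time (req i))))).
  apply: ler_sum => j _; apply: window_count; first exact: step_gt0.
  by move=> i; rewrite inE => /andP[/st].
rewrite big_split /=; apply: lerD.
  have : \sum_(j < K | B j != finset.set0) m * 2 ^+ j <= 2 * service_weight s.
    apply: (@geometric_sum_le _ _ _ (fun j => B j != finset.set0)) => //.
    - exact: ltW.
    - exact: service_weight_ge0.
    - move=> j /set0Pn[i]; rewrite inE => /andP[si /andP[+ _]].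
      by move=> /le_trans; apply; exact: dist_le_service_weight.
  have -> : \sum_(j < K) (B j != finset.set0)%:R * (5 * step j) =
      5 / 4 * \sum_(j < K | B j != finset.set0) m * 2 ^+ j.
    rewrite big_distrr /= [RHS]big_mkcond /=; apply: eq_bigr => j _.
    rewrite /step /scale.
    by case: ifP => _ /=; [rewrite mul1r; field | rewrite mul0r].
  by lra.
under eq_bigr do rewrite big_mkcond /=.
rewrite exchange_big /= /service_delay [leRHS]big_mkcond /=; apply: ler_sum => i _.
have [si|si] := boolP (i \in s.2); last first.
  by rewrite big1 // => j _; rewrite inE (negPf si).
have d0 : 0 <= s.1 - arrival_time (req i) by rewrite subr_ge0 st.
(* Depth classes are disjoint, so the delay of a request is charged at most once. *)
case: (pickP (fun j : 'I_K => depth_class j (location (req i)))) => [j ij|no].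
  rewrite (bigD1 j) //= inE si ij /= big1 ?addr0 // => j' jj'.
  rewrite inE si /=; case: ifP => // ij'.
  by case/eqP: jj'; apply: val_inj; exact: depth_class_inj ij' ij.
by rewrite big1 // => j _; rewrite inE si /= no.
Qed.

(** Every request belongs to some service, so a hit window is counted for at least one service, and
    the bounds per service add up. The delay coefficient [1] is relaxed to [5 / 2]. *)
Lemma schedule_lower_bound sigma (S : seq (service sigma)) K (n : nat -> nat) :
  is_schedule S ->
  \sum_(j < K) \sum_(k < n j) step j * (class_hit sigma j k)%:R <= 5 / 2 * cost S.
Proof.
move=> [_ /and3P[/eqP cS _ _] St].
have hitS j k : (class_hit sigma j k)%:R <= \sum_(s <- S)
    [exists i in s.2, depth_class j (location (req i)) &&
       window (step j) k (arrival_time (req i))]%:R :> R.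
  have [/hasP[r rs rjk]|_] := boolP (class_hit sigma j k); last exact: sumr_ge0.
  have [i ri] : exists i, req (sigma := sigma) i = r.
    by have /tnthP[i ->] : r \in in_tuple sigma by []; exists i.
  have : i \in finset.cover [set B in [seq s.2 | s <- S]]%SET by rewrite cS inE.
  case/bigcupP => _ /[!inE] /mapP[s sS ->] si.
  rewrite (perm_big _ (perm_to_rem sS)) big_cons.
  have -> : [exists i in s.2, depth_class j (location (req i)) &&
       window (step j) k (arrival_time (req i))].
    by apply/exists_inP; exists i; rewrite // ri.
  by rewrite lerDl; apply: sumr_ge0.
apply: (@le_trans _ _ (\sum_(s <- S) (5 / 2 * service_weight s + service_delay s))).
  apply: (@le_trans _ _ (\sum_(s <- S) \sum_(j < K) \sum_(k < n j) step j *
     [exists i in s.2, depth_class j (location (req i)) &&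
                       window (step j) k (arrival_time (req i))]%:R)).
    rewrite exchange_big /=; apply: ler_sum => j _; rewrite exchange_big /=.
    apply: ler_sum => k _; rewrite -big_distrr /=.
    by rewrite ler_pM2l ?step_gt0.
  rewrite big_seq [leRHS]big_seq; apply: ler_sum => s sS.
  exact/service_lower_bound/St.
rewrite big_split /= -big_distrr /= /cost mulrDr lerD2l.
have : 0 <= \sum_(s <- S) service_delay s.
  by rewrite big_seq sumr_ge0 // => s /St; exact: service_delay_ge0.
by lra.
Qed.

End LowerBound.

(** * Integration, the Poisson mean and exponential estimates *)

Section Analysis.
Local Open Scope classical_set_scope.
Local Open Scope ring_scope.
Context {R : realType}.

(* The integral of a nonnegative function is a lower integral, hence monotone
   even for functions that are not measurable, such as the cost of OPT. *)
Lemma ge0_le_integral_nonmeasurable d (X : measurableType d)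
    (mu : {measure set X -> \bar R}) (f g : X -> \bar R) :
  (forall x, (0 <= f x)%E) -> (forall x, (f x <= g x)%E) ->
  (\int[mu]_x f x <= \int[mu]_x g x)%E.
Proof.
move=> f0 fg; have g0 x : (0 <= g x)%E by exact: le_trans (f0 x) (fg x).
rewrite !ge0_integralTE //; apply: ge_ereal_sup => _ [h /= hf <-].
by apply: ereal_sup_ubound; exists h => // x; exact: le_trans (hf x) (fg x).
Qed.

(** Raising [g] to [+oo] on the exceptional null set makes the domination hold everywhere without
    changing the integral of [g]. *)
Lemma le_integral_ae_nonmeasurable d (X : measurableType d)
    (mu : {measure set X -> \bar R}) (f g : X -> \bar R) :
  (forall x, (0 <= f x)%E) -> (forall x, (0 <= g x)%E) ->
  measurable_fun setT g -> {ae mu, forall x, (f x <= g x)%E} ->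
  (\int[mu]_x f x <= \int[mu]_x g x)%E.
Proof.
move=> f0 g0 mg [N [mN N0 fgN]].
pose g' x := if x \in N then +oo%E else g x.
have mg' : measurable_fun setT g'.
  apply: measurable_fun_if => //.
    apply: (measurable_fun_bool true); rewrite setTI (_ : _ @^-1` _ = N) //.
    by apply/seteqP; split => x /=; [exact: set_mem|exact: mem_set].
  exact: measurable_funS mg.
have g'0 x : (0 <= g' x)%E by rewrite /g'; case: ifP; rewrite ?leey.
rewrite -[leRHS](@ge0_ae_eq_integral _ _ _ mu setT g' g) //; last first.
  exists N; split => // x /= xN; apply: contrapT => nN; apply: xN => _.
  by rewrite /g' memNset.
apply: ge0_le_integral_nonmeasurable => // x; rewrite /g'.
have [xN|xN] := boolP (x \in N); first exact: leey.
apply: contrapT => fgx; move: xN; rewrite notin_setE; apply; exact: fgN.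
Qed.

(** Writing [N] as the series of [k] times the indicator of [N = k] and integrating termwise leaves
    the exponential series, shifted by one. *)
Lemma poisson_mean d (X : measurableType d) (P : probability X R) (a : R)
    (N : X -> nat) :
  measurable_fun setT N ->
  (forall k, P [set w | N w = k] = (a ^+ k / k`!%:R * expR (- a))%:E) ->
  0 <= a -> (\int[P]_w (N w)%:R%:E = a%:E)%E.
Proof.
move=> mN PN a0.
have mNk k : measurable [set w | N w = k].
  by rewrite -[X in measurable X]setTI; exact: (mN measurableT [set k]).
have NE w : ((N w)%:R%:E =
    \sum_(0 <= k <oo) (k%:R%:E * (\1_[set w | N w = k] w)%:E) :> \bar R)%E.
  (* At each [w] the partial sums are constant once [n] exceeds [N w]. *)
  apply/esym/lim_near_cst => //; near=> n.
  have Nn : (N w < n)%N by near: n; exact: nbhs_infty_gt.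
  rewrite big_mkord (bigD1 (Ordinal Nn)) //= big1 ?adde0 => [|i iN].
    by rewrite indicE mem_set // mule1.
  rewrite indicE memNset ?mule0 //= => Nwi; case/eqP: iN; exact: val_inj.
under eq_integral do rewrite NE.
rewrite integral_nneseries //; last first.
  move=> k; apply: emeasurable_funM => //.
  by apply/measurable_EFinP; exact: measurable_indic.
have -> : (fun n => \sum_(0 <= k < n)
    \int[P]_w (k%:R%:E * (\1_[set w | N w = k] w)%:E))%E =
    (fun n => (\sum_(0 <= k < n) k%:R * (a ^+ k / k`!%:R * expR (- a)))%:E).
  apply/funext => n; rewrite -sumEFin; apply: eq_bigr => k _.
  rewrite ge0_integralZl_EFin //; last first.
    by apply/measurable_EFinP; exact: measurable_indic.
  by rewrite integral_indic // setIT EFinM; congr (_ * _)%E; exact: PN.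
apply: cvg_lim => //; apply: cvg_EFin; first exact: nearW.
rewrite -cvg_shiftS.
have -> : [sequence fine (\sum_(0 <= k < n.+1)
      k%:R * (a ^+ k / k`!%:R * expR (- a)))%:E]_n
   = (fun n => a * expR (- a) * series (exp_coeff a) n).
  apply/funext => n; rewrite /series /= big_nat_recl // mul0r add0r big_distrr /=.
  apply: eq_bigr => k _; rewrite /exp_coeff /= factS exprS natrM.
  have kf : k`!%:R != 0 :> R by rewrite pnatr_eq0 -lt0n fact_gt0.
  have k1 : k.+1%:R != 0 :> R by rewrite pnatr_eq0.
  by field; rewrite kf nat1r k1.
have ea : a * expR (- a) * expR a = a by rewrite -mulrA -expRD addNr expR0 mulr1.
have := @cvgMl_tmp _ _ _ _ _ (a * expR (- a)) _ (is_cvg_series_exp_coeff a).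
rewrite -[lim _]/(expR a) ea; exact.
Unshelve. all: by end_near. Qed.

(** By convexity, [expR (- x)] lies below its chord over [[0, 1]]. *)
Lemma expRN_chord (x : R) : 0 <= x <= 1 -> x * (1 - expR (- 1)) <= 1 - expR (- x).
Proof.
move=> /andP[x0 x1].
(* tangents at [- x], evaluated at [0] and [- 1] *)
have t0 : expR (- x) * (1 + x) <= 1.
  apply: le_trans (ler_wpM2l (expR_ge0 _) (expR_ge1Dx x)) _.
  by rewrite -expRD addNr expR0.
have t1 : expR (- x) * x <= expR (- 1).
  have := ler_wpM2l (expR_ge0 (- x)) (expR_ge1Dx (x - 1)).
  by rewrite -expRD addKr [1 + _]addrC subrK.
(* The weights [x] and [1 - x] combine the two bounds, since [x * x + (1 - x) * (1 + x) = 1]. *)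
have := ler_wpM2l x0 t1.
have := @ler_wpM2l _ (1 - x) _ _ _ t0; rewrite subr_ge0 => /(_ x1).
by lra.
Qed.

Lemma ratio_constant_lt : 16 / (3 - 3 * expR (- 1)) < 844 / 100 :> R.
Proof.
(* [1957 / 720] is the sum of the inverse factorials of [0] to [6]. *)
have e : 1957 / 720 <= expR 1 :> R.
  have nd : nondecreasing_seq (series (exp_coeff (1 : R))).
    by apply: nondecreasing_series => n _ _; exact: exp_coeff_ge0.
  apply: le_trans (nondecreasing_cvgn_le nd (is_cvg_series_exp_coeff 1) 7).
  by rewrite /series /= unlock /= /exp_coeff /= !expr1n !factS fact0; lra.
have e0 : expR (- 1) <= 720 / 1957 :> R.
  rewrite expRN -[leLHS]mul1r ler_pdivrMr ?expR_gt0 //.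
  by move: e; lra.
have p : 0 < 3 - 3 * expR (- 1) :> R by move: e0; lra.
by rewrite ltr_pdivrMr //; move: e0; lra.
Qed.

End Analysis.

(** * Expected costs under Poisson requests *)

Section PoissonRequests.
Local Open Scope classical_set_scope.
Local Open Scope ring_scope.
Context {R : realType} {T : wtree R} (lambda : T -> R) (tau : R).
Context d (Omega : measurableType d) (P : probability Omega R).
Variable sigma : Omega -> seq (request T).
Hypothesis lambda_ge0 : forall u, 0 <= lambda u.
Hypothesis tau_ge0 : 0 <= tau.
Hypothesis sigmaP : poisson_requests lambda tau P sigma.
Implicit Types (u : T) (C : pred T).

Definition void C (s t : R) : set Omega :=
  [set w | forall u, C u -> arrivals u s t (sigma w) = 0%N].

Lemma measurable_arrivals_eq u (s t : R) k : 0 <= s -> s <= t -> t <= tau ->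
  measurable [set w | arrivals u s t (sigma w) = k].
Proof.
move=> s0 st tt; have [_ _ mA _ _] := sigmaP.
by rewrite -[X in measurable X]setTI; exact: (mA u s t s0 st tt measurableT [set k]).
Qed.

Lemma measurable_void C (s t : R) : 0 <= s -> s <= t -> t <= tau ->
  measurable (void C s t).
Proof.
move=> s0 st tt.
have -> : void C s t =
    \bigcap_(u in [set u | C u]) [set w | arrivals u s t (sigma w) = 0%N].
  by apply/seteqP; split.
apply: fin_bigcap_measurable => [|u _]; first exact: finite_finset.
exact: measurable_arrivals_eq.
Qed.

(** Independence over the single interval from [s] to [t] gives a product of exponentials; vertices
    outside [C] contribute the factor [1] through [setT]. *)
Lemma void_probability C (s t : R) : 0 <= s -> s <= t -> t <= tau ->
  P (void C s t) = (expR (- ((\sum_(u | C u) lambda u) * (t - s))))%:E.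
Proof.
move=> s0 st tt; have [_ _ _ pois indep] := sigmaP.
pose ts j := if j == 0%N then s else t.
have ts_le j : (j < 1)%N -> ts j <= ts j.+1 by case: j.
have := indep 1%N ts s0 tt ts_le (fun uj => if C uj.1 then [set 0%N] else setT).
have -> : [set w | forall i : T * 'I_1, (if C i.1 then [set 0%N] else setT)
    (arrivals i.1 (ts i.2) (ts i.2.+1) (sigma w))] = void C s t.
  apply/seteqP; split => w /= Cw.
    by move=> u Cu; have := Cw (u, ord0); rewrite /= Cu.
  by case=> u j /=; case: ifPn => // Cu; rewrite (ord1 j); exact: Cw.
move=> ->; rewrite -(pair_bigA _ (fun u (j : 'I_1) =>
    P ((fun w => arrivals u (ts j) (ts j.+1) (sigma w)) @^-1`
       (if C u then [set 0%N] else setT)))) /=.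
rewrite mulr_suml -sumrN (big_morph expR (@expRD R) (@expR0 R)) -prodEFin.
rewrite [RHS]big_mkcond /=; apply: eq_bigr => u _; rewrite big_ord1 /=.
case: ifPn => Cu; last by rewrite preimage_setT probability_setT.
by rewrite [LHS](pois u s t s0 st tt 0%N) expr0 fact0 divr1 mul1r.
Qed.

(** [arrivals u 0 tau] leaves out time [0], hence the hypothesis on arrival times. *)
Lemma cost_INSTANT_arrivals w :
  (forall r, r \in sigma w -> arrival_time r != 0) ->
  cost (INSTANT (sigma w)) =
    \sum_u dist u (Defs.root T) * (arrivals u 0 tau (sigma w))%:R.
Proof.
move=> r0; have [inT _ _ _ _] := sigmaP.
rewrite cost_INSTANT.
under [RHS]eq_bigr do
  rewrite /arrivals -sum1_count natr_sum big_distrr big_mkcond /=.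
rewrite exchange_big /= big_seq [RHS]big_seq; apply: eq_bigr => r rs.
rewrite (bigD1 (location r)) //= big1 => [|u /negPf ur]; last first.
  by rewrite eq_sym ur.
have /andP[t0 tt] := inT _ _ rs.
by rewrite eqxx lt_neqAle eq_sym (r0 _ rs) t0 tt mulr1 addr0.
Qed.

(** Almost surely no request arrives at time [0], so the cost is almost everywhere a weighted sum of
    Poisson counts with means [lambda u * tau]. *)
Lemma expectation_INSTANT_le :
  ('E_P[fun w => cost (INSTANT (sigma w))] <= (tau * heaviness lambda)%:E)%E.
Proof.
have [_ ae0 mA pois _] := sigmaP.
rewrite expectation.unlock.
pose g u w := ((dist u (Defs.root T))%:E * (arrivals u 0 tau (sigma w))%:R%:E)%E.
have mN u : measurable_fun setT (fun w => (arrivals u 0 tau (sigma w))%:R%:E : \bar R).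
  apply/measurable_EFinP.
  apply: (measurableT_comp (f := fun k : nat => k%:R : R)); last exact: mA.
  by move=> ? Y ?.
have mg u : measurable_fun setT (g u) by exact: emeasurable_funM.
have g0 u w : (0 <= g u w)%E by rewrite mule_ge0 // lee_fin // dist_ge0.
apply: (@le_trans _ _ (\int[P]_w \sum_u g u w)%E).
  apply: le_integral_ae_nonmeasurable => [w|w||].
  - rewrite lee_fin; exact/cost_ge0/INSTANT_schedule.
  - exact: sume_ge0.
  - exact: emeasurable_sum.
  - move: ae0; apply: filterS => w r0.
    rewrite cost_INSTANT_arrivals // -sumEFin.
    by under eq_bigr do rewrite EFinM.
rewrite ge0_integral_sum // /heaviness big_distrr /= -sumEFin.
apply: lee_sum => u _.
rewrite ge0_integralZl_EFin // ?dist_ge0 //.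
rewrite (@poisson_mean _ _ _ _ (lambda u * tau)) ?mulr_ge0 //; last 2 first.
- exact: mA.
- by move=> k; have := pois u 0 tau (lexx 0) tau_ge0 (lexx tau) k; rewrite /= subr0.
by rewrite -EFinM lee_fin mulrC [lambda u * _]mulrC mulrA.
Qed.

Lemma class_hitE m j k w :
  class_hit m (sigma w) j k =
  (w \in ~` void (depth_class m j) (k%:R * step m j) ((k + 4)%:R * step m j))
  :> bool.
Proof.
apply/idP/idP => [/hasP[r rs /andP[rj rk]]|].
  rewrite inE => /(_ _ rj)/eqP; rewrite -leqn0 leqNgt -has_count => /hasP[].
  by exists r => //=; rewrite eqxx.
rewrite inE; apply: contra_notT => /hasPn nr u uj; apply/eqP.
rewrite -leqn0 leqNgt -has_count; apply/hasPn => r rs /=.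
by apply: contra (nr r rs) => /andP[/eqP -> rk]; rewrite uj.
Qed.

(** The hit windows bound the cost of [OPT] pathwise, and linearity of expectation copes with
    overlapping windows. The last window of class [j] ends at [(n j + 3)%:R * step m j], which must
    not exceed [tau]. *)
Lemma expectation_OPT_ge m K (n : nat -> nat) :
  0 < m -> (forall j, (j < K)%N -> (0 < n j)%N -> (n j + 3)%:R * step m j <= tau) ->
  ((2 / 5 * \sum_(j < K) (n j)%:R * step m j *
      (1 - expR (- ((\sum_(u | depth_class m j u) lambda u) * scale m j))))%:E
    <= 'E_P[fun w => cost (OPT (sigma w))])%E.
Proof.
move=> m0 nT; rewrite expectation.unlock.
pose V j k := void (depth_class m j) (k%:R * step m j) ((k + 4)%:R * step m j).
have h0 j := ltW (step_gt0 m0 j).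
have Vb (j : 'I_K) (k : 'I_(n j)) : [/\ 0 <= k%:R * step m j,
    k%:R * step m j <= (k + 4)%:R * step m j & (k + 4)%:R * step m j <= tau].
  split; first by rewrite mulr_ge0.
    by rewrite ler_wpM2r // ler_nat leq_addr.
  apply: le_trans (nT j (ltn_ord j) (leq_ltn_trans _ (ltn_ord k))); rewrite //.
  by rewrite ler_wpM2r // ler_nat addnS ltn_add2r.
have mV (j : 'I_K) (k : 'I_(n j)) : measurable (~` V j k).
  by have [? ? ?] := Vb j k; apply: measurableC; exact: measurable_void.
have mI (j : 'I_K) (k : 'I_(n j)) :
    measurable_fun setT (fun w => (\1_(~` V j k) w)%:E : \bar R).
  by apply/measurable_EFinP; exact: measurable_indic.
have c0 j : 0 <= 2 / 5 * step m j by rewrite mulr_ge0 //; exact: h0.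
pose g (j : 'I_K) (k : 'I_(n j)) w :=
  ((2 / 5 * step m j)%:E * (\1_(~` V j k) w)%:E : \bar R)%E.
have mg j k : measurable_fun setT (@g j k) by exact: emeasurable_funM.
have g0 j k w : (0 <= @g j k w)%E by rewrite mule_ge0 // lee_fin.
apply: (@le_trans _ _ (\int[P]_w \sum_(j < K) \sum_(k < n j) @g j k w)%E); last first.
  apply: ge0_le_integral_nonmeasurable => w.
    by apply: sume_ge0 => j _; exact: sume_ge0.
  under eq_bigr do rewrite sumEFin.
  rewrite sumEFin lee_fin.
  have := schedule_lower_bound m0 K n (OPT_schedule (sigma w)).
  have c25 : 0 <= 2 / 5 :> R by lra.
  move=> /(ler_wpM2l c25); rewrite [leRHS]mulrA.
  have -> : 2 / 5 * (5 / 2) = 1 :> R by lra.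
  rewrite mul1r; apply: le_trans; rewrite big_distrr /=; apply: ler_sum => j _.
  rewrite big_distrr /=; apply: ler_sum => k _.
  by rewrite class_hitE indicE [leRHS]mulrA.
rewrite ge0_integral_sum //; last 2 first.
- by move=> j; exact: emeasurable_sum.
- by move=> j w _; exact: sume_ge0.
rewrite big_distrr /= -sumEFin; apply: lee_sum => j _.
rewrite ge0_integral_sum //.
set e := expR _.
apply: (@le_trans _ _ (\sum_(k < n j) (2 / 5 * step m j * (1 - e))%:E)%E).
  by rewrite sumEFin lee_fin sumr_const card_ord -[leRHS]mulr_natl; lra.
apply: lee_sum => k _; rewrite ge0_integralZl_EFin // integral_indic // setIT.
have [k1 k2 k3] := Vb j k.
(* The window has length [4 * step m j], which is [scale m j]. *)
have PV : (P (~` V j k) = (1 - e)%:E)%E.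
  rewrite probability_setC; last exact: measurable_void.
  rewrite void_probability // EFinB /e; congr (1 - (expR (- (_ * _)))%:E)%E.
  by rewrite natrD /step; field.
by rewrite [X in (_ <= _ * X)%E](_ : _ = (1 - e)%:E) // -EFinM.
Qed.

End PoissonRequests.

(** * Choice of scales and the estimate for light instances *)

Section LightInstances.
Local Open Scope ring_scope.
Context {R : realType} {T : wtree R}.
Implicit Types (lambda : T -> R) (u : T).

(** Window [k] fits when [k + 4] is at most the truncated quotient; truncated subtraction gives [0]
    when none fits. *)
Definition num_windows (m tau : R) j : nat :=
  (Num.truncn (tau / step m j) - 3)%N.

Lemma depth_class_exists m K u :
  scale m 0 <= dist u (Defs.root T) < scale m K ->
  exists j : 'I_K, depth_class m j u.
Proof.
elim: K => [|K IHK] /andP[u0 uK].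
  by have := le_lt_trans u0 uK; rewrite ltxx.
have [uK'|Ku] := ltP (dist u (Defs.root T)) (scale m K).
  have [|j uj] := IHK; first by rewrite u0.
  by exists (widen_ord (leqnSn K) j).
by exists ord_max; rewrite /depth_class Ku.
Qed.

(** [m] is the least positive depth, with [1] as default and cap; [K] is such that [2 ^+ K] exceeds
    the sum of all depths divided by [m]. *)
Lemma scale_exists : exists m K, [/\ 0 < m :> R & forall u,
  0 < dist u (Defs.root T) -> scale m 0 <= dist u (Defs.root T) < scale m K].
Proof.
pose D u := dist u (Defs.root T).
pose m := \big[Num.min/1]_(u | 0 < D u) D u.
have m0 : 0 < m by apply: (big_ind (fun x => 0 < x)) => // x y x0 y0; rewrite lt_min x0.
pose S := \sum_u D u.
have S0 : 0 <= S by apply: sumr_ge0 => u _; exact: dist_ge0.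
exists m, (Num.truncn (S / m)).+1; split => // u u0; apply/andP; split.
  rewrite /scale expr0 mulr1 /m (bigD1 u) //=.
  by rewrite ge_min lexx.
have uS : D u <= S.
  by rewrite /S (bigD1 u) //= lerDl; apply: sumr_ge0 => v _; exact: dist_ge0.
apply: le_lt_trans uS _.
have /andP[_ St] := truncn_itv (divr_ge0 S0 (ltW m0)).
rewrite /scale mulrC -ltr_pdivrMr //; apply: lt_trans St _.
by rewrite -natrX ltr_nat ltn_expl.
Qed.

Lemma light_bound lambda (m tau : R) K :
  0 < m -> 0 < tau ->
  (forall u, 0 <= lambda u) -> light lambda ->
  (forall u, 0 < dist u (Defs.root T) ->
     scale m 0 <= dist u (Defs.root T) < scale m K) ->
  16 * scale m K <= tau ->
  3 / 16 * (1 - expR (- 1)) * (tau * heaviness lambda) <=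
  2 / 5 * \sum_(j < K) (num_windows m tau j)%:R * step m j *
     (1 - expR (- ((\sum_(u | depth_class m j u) lambda u) * scale m j))).
Proof.
move=> m0 t0 l0 li mK tK; set n := num_windows m tau.
pose D u := dist u (Defs.root T).
pose x j := (\sum_(u | depth_class m j u) lambda u) * scale m j.
have x0 j : 0 <= x j.
  by rewrite mulr_ge0 ?sumr_ge0 // ltW // scale_gt0.
(* In class [j] the depth is at least [scale m j], so [x j] is at most the heaviness. *)
have x1 j : x j <= 1.
  apply: le_trans li; rewrite /x mulr_suml /heaviness big_mkcond /=.
  apply: ler_sum => u _; case: ifP => [/andP[uj _]|_].
    exact: ler_wpM2l.
  by rewrite mulr_ge0 // dist_ge0.
have e1 : 0 <= 1 - expR (- 1) :> R.
  by rewrite subr_ge0 -[leRHS](@expR0 R) ler_expR; lra.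
(* The loss is at most [4 * step m j = scale m j], hence at most [tau / 16]. *)
have nh (j : 'I_K) : 15 / 16 * tau <= (n j)%:R * step m j.
  have hj := step_gt0 m0 j.
  have q0 : 0 <= tau / step m j by rewrite divr_ge0 // ltW.
  have /andP[_ qt] := truncn_itv q0.
  have nge : tau / step m j - 4 <= (n j)%:R.
    rewrite lerBlDr -natrD; apply: le_trans (ltW qt) _.
    by rewrite ler_nat /n /num_windows; lia.
  have := ler_wpM2r (ltW hj) nge; rewrite mulrBl divfK ?gt_eqF //.
  have : scale m j <= scale m K by apply: le_scale => //; exact: ltnW.
  have -> : 4 * step m j = scale m j by rewrite /step; field.
  by move: tK; lra.
(* Depths in class [j] are below [2 * scale m j]; vertices at depth [0] add nothing to the
   heaviness. *)
have sx : heaviness lambda / 2 <= \sum_(j < K) x j.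
  rewrite /heaviness mulr_suml.
  under [leRHS]eq_bigr do rewrite /x mulr_suml big_mkcond /=.
  rewrite exchange_big /=; apply: ler_sum => u _.
  have s0 (j : 'I_K) : 0 <= (if depth_class m j u then lambda u * scale m j else 0).
    by case: ifP => // _; rewrite mulr_ge0 // ltW // scale_gt0.
  have [u0|u0] := ltP 0 (D u); last first.
    have -> : dist u (Defs.root T) = 0 by apply/le_anti; rewrite u0 dist_ge0.
    by rewrite mulr0 mul0r; apply: sumr_ge0.
  have [j uj] := depth_class_exists (mK u u0).
  rewrite (bigD1 j) //= uj; apply: ler_wpDr; first exact: sumr_ge0.
  rewrite -mulrA; apply: ler_wpM2l => //.
  have /andP[_] := uj; rewrite /scale exprS.
  by lra.
apply: (@le_trans _ _ (2 / 5 * \sum_(j < K) 15 / 16 * tau * (x j * (1 - expR (- 1))))).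
  rewrite -big_distrr -big_distrl /=.
  have := ler_wpM2r e1 (ler_wpM2l (ltW t0) sx).
  by lra.
rewrite ler_pM2l //; apply: ler_sum => j _.
apply: ler_pM => //; first by rewrite mulr_ge0 // ltW.
  by rewrite mulr_ge0.
by apply: expRN_chord; rewrite x0 x1.
Qed.

End LightInstances.

(** * The competitive ratio *)

(** The quotient is [0] when [x = 0], whatever [y] is, and when [y = +oo]. Otherwise [x > 0] forces
    [b > 0], hence [y > 0]. *)
Lemma ratio_le {R : realType} (x y : \bar R) (a b C : R) :
  (0 <= x)%E -> (x <= a%:E)%E -> (b%:E <= y)%E ->
  (0 <= b)%R -> (0 <= C)%R -> (a <= C * b)%R -> (x / y <= C%:E)%E.
Proof.
move=> x0 xa yb b0 C0 ab.
have [<-|xpos] := eqVneq 0%E x; first by rewrite mul0e lee_fin.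
have {xpos}x0 : (0 < x)%E by rewrite lt_def x0 eq_sym xpos.
case: y yb => [y| |] yb; last by [].
  move: x xa x0 => [x| |] //; rewrite !lee_fin lte_fin => xa x0.
  rewrite lee_fin in yb.
  have bpos : (0 < b)%R.
    rewrite lt_def b0 andbT; apply: contraTneq x0 => b00.
    by rewrite -leNgt (le_trans xa) // (le_trans ab) // b00 mulr0.
  have ypos := lt_le_trans bpos yb.
  rewrite inver gt_eqF // -EFinM lee_fin ler_pdivrMr //.
  by rewrite (le_trans xa) // (le_trans ab) // ler_wpM2l.
by rewrite invey mule0 lee_fin.
Qed.

Theorem theorem2 (R : realType) (T : wtree R) (lambda : T -> R)
    (d : measure_display) (Omega : R -> measurableType d)
    (P : forall tau : R, probability (Omega tau) R)
    (sigma : forall tau : R, Omega tau -> seq (request T)) :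
  stochastic_instance lambda -> light lambda ->
  (forall tau : R, (0 < tau)%R ->
     poisson_requests lambda tau (P tau) (sigma tau)) ->
  (limf_esup
     (fun tau : R =>
        'E_(P tau)[fun w => cost (INSTANT (sigma tau w))]
        / 'E_(P tau)[fun w => cost (OPT (sigma tau w))]) +oo%R
     <= (16 / (3 - 3 * expR (- 1)))%:E)%E
  /\ (16 / (3 - 3 * expR (- 1)) < 844 / 100 :> R)%R.
Proof.
move=> [lambda0 _] li sigmaP; split; last exact: ratio_constant_lt.
have [m [K [m0 mK]]] := @scale_exists R T.
have c0 : (0 < 1 - expR (- 1) :> R)%R.
  by rewrite subr_gt0 -[ltRHS](@expR0 R) ltr_expR; lra.
have M0 := scale_gt0 m0 K.
(* The limit superior is an infimum over neighbourhoods of [+oo]; on the half-line from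
   [16 * scale m K] every ratio satisfies the bound. *)
apply: ge_ereal_inf; exists (ereal_sup [set
    ('E_(P tau)[fun w => cost (INSTANT (sigma tau w))]
     / 'E_(P tau)[fun w => cost (OPT (sigma tau w))])%E
    | tau in [set tau | 16 * scale m K <= tau]%R])%classic.
  exists [set tau | 16 * scale m K <= tau]%R%classic => //.
  by apply: nbhs_pinfty_ge; exact: num_real.
apply: ge_ereal_sup => _ [tau /= tauM <-].
have t0 : (0 < tau)%R by move: tauM M0; lra.
have sP := sigmaP tau t0.
apply: (ratio_le (a := tau * heaviness lambda)
    (b := 3 / 16 * (1 - expR (- 1)) * (tau * heaviness lambda))).
- rewrite expectation.unlock; apply: integral_ge0 => w _; rewrite lee_fin.
  exact/cost_ge0/INSTANT_schedule.
- exact: expectation_INSTANT_le (ltW t0) sP.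
- apply: le_trans (expectation_OPT_ge (K := K) (n := num_windows m tau) sP m0 _).
    by rewrite lee_fin; exact: light_bound.
  move=> j _; rewrite /num_windows subn_gt0 => n3.
  rewrite subnK; last exact: ltnW.
  rewrite -ler_pdivlMr ?step_gt0 //.
  by have /andP[] := truncn_itv (divr_ge0 (ltW t0) (ltW (step_gt0 m0 j))).
- have h0 : (0 <= heaviness lambda)%R.
    by apply: sumr_ge0 => u _; rewrite mulr_ge0 // dist_ge0.
  by rewrite !mulr_ge0 // ltW.
- by rewrite divr_ge0 //; move: c0; lra.
have c3 : (3 - 3 * expR (- 1) != 0 :> R)%R by rewrite gt_eqF //; move: c0; lra.
(* The constant is the inverse of [3 / 16 * (1 - expR (- 1))], so equality holds. *)
rewrite le_eqVlt; apply/orP; left; apply/eqP.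
by field.
Qed.
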